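(* For every $t\in\mathbb N_0$, $$\mathbf P(t)=\Phi^{(0)}(t)\,(\mathbf 1-\mathbf R)\,\mathbf W^t+\mathbf R\,\bar f(t,\mathbf W),\qquad \bar f(t,\mathbf W)=\sum_{b=0}^{t}f(t,b)\,\mathbf W^b ,$$ where the distribution of the backward recurrence time is given by $$f(t,b)=\Phi^{(0)}(b)\,\bigl(\delta_{tb}+\mathcal R(t-b)\bigr),\qquad b,t\in\mathbb N_0 .$$ Moreover, $\mathbf P$ satisfies the renewal equation $$\mathbf P(t)=\Phi^{(0)}(t)\,\mathbf W^t+\mathbf R\sum_{k=1}^{t}\psi(k)\,\mathbf P(t-k),\qquad t\in\mathbb N_0,$$ and its generating function $\bar{\mathbf P}(u)=\sum_{t\ge0}u^t\mathbf P(t)$ is $$\bar{\mathbf P}(u)=\Bigl(\mathbf 1+\frac{\bar\psi(u)}{1-\bar\psi(u)}\,\mathbf R\Bigr)\,\bigl(\mathbf 1-\bar\psi(u\mathbf W)\bigr)\,(\mathbf 1-u\mathbf W)^{-1},\qquad |u|<1 .$$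
   Context: Let $\mathbf A=(A_{ij})$ be the $0/1$ symmetric adjacency matrix, with $A_{ii}=0$, of a finite connected undirected non-bipartite graph on nodes $1,\dots,N$; let $K_i=\sum_jA_{ij}$ and $\mathbf W=(W_{ij})$, $W_{ij}=A_{ij}/K_i$. Let $\mathbf R$ be the $N\times N$ matrix with identical rows, $R_{ij}=R_j$, where $R_j\ge0$ and $\sum_jR_j=1$ (relocation matrix). $\mathbf 1$ is the identity matrix. Let $\Delta t_1,\Delta t_2,\dots$ be i.i.d. random variables with values in $\mathbb N=\{1,2,\dots\}$ and law $\psi(r)=\mathbb P[\Delta t_1=r]$, $\psi(0)=0$, with generating function $\bar\psi(u)=\sum_{r\ge1}\psi(r)u^r$; for a matrix argument, $\bar\psi(\mathbf M)=\sum_{r\ge1}\psi(r)\mathbf M^r$. Put $J_0=0$, $J_n=\Delta t_1+\dots+\Delta t_n$ (reset times), $\mathcal N(t)=\max\{n\ge0:J_n\le t\}$, $\Phi^{(0)}(t)=\sum_{r>t}\psi(r)$, and $\Theta(J_n,t,J_{n+1})=1$ if $J_n\le t\le J_{n+1}-1$ and $0$ otherwise. The brackets $\langle\cdot\rangle$ denote expectation. The resetting rate is $\mathcal R(t)=\sum_{n\ge1}\mathbb P[J_n=t]$ for $t\ge1$, and $\mathcal R(t)=0$ for $t\le0$. The backward recurrence time is $B_t=t-J_{\mathcal N(t)}$, and $f(t,b)=\mathbb P[B_t=b]$. The propagator (transition matrix) of the walk with resets is $$\mathbf P(t)=\mathbf W^t\,\langle\Theta(J_0,t,J_1)\rangle+\mathbf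 R\sum_{n=1}^\infty\bigl\langle\Theta(J_n,t,J_{n+1})\,\mathbf W^{t-J_n}\bigr\rangle,\qquad t\in\mathbb N_0 .$$ *)

(* Defs.v *)
From HB Require Import structures.
From mathcomp Require Import all_boot all_order all_algebra finmap.
From mathcomp Require Import complex.
From mathcomp Require Import all_classical all_reals all_analysis.

Set Implicit Arguments.
Unset Strict Implicit.
Unset Printing Implicit Defensive.
Import Order.TTheory GRing.Theory Num.Theory.
Import numFieldNormedType.Exports.

Local Open Scope classical_set_scope.
Local Open Scope ring_scope.

(* [R[i]] itself carries no topology in the library; as a [numClosedFieldType]
   it inherits the one induced by the modulus. *)
Definition cplx (R : realType) : numClosedFieldType := R[i].

Definition to_cplx (R : realType) (x : R) : cplx R := real_complex R x.

Definition to_cplx_mx (R : realType) (N : nat) (M : 'M[R]_N) : 'M[cplx R]_N :=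
  map_mx (@to_cplx R) M.

Definition bipartite (N : nat) (e : rel 'I_N) : Prop :=
  exists c : 'I_N -> bool, forall i j, e i j -> c i != c j.

Definition adjacency_mx (R : realType) (N : nat) (e : rel 'I_N) : 'M[R]_N :=
  \matrix_(i, j) (e i j)%:R.

Definition degree (R : realType) (N : nat) (A : 'M[R]_N) (i : 'I_N) : R :=
  \sum_j A i j.

Definition walk_mx (R : realType) (N : nat) (A : 'M[R]_N) : 'M[R]_N :=
  \matrix_(i, j) (A i j / degree A i).

Definition relocation_mx (R : realType) (N : nat) (rho : 'I_N -> R) : 'M[R]_N :=
  \matrix_(i, j) rho j.

Definition mutually_independent (R : realType) (d d' : measure_display)
    (T : measurableType d) (T' : measurableType d') (Pr : probability T R)
    (I : choiceType) (X : I -> {RV Pr >-> T'}) : Prop :=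
  forall (s : {fset I}) (B : I -> set T'), (forall i, measurable (B i)) ->
    Pr (\bigcap_(i in [set` s]) (X i @^-1` B i)) =
    (\prod_(i <- s) Pr (X i @^-1` B i))%E.

Definition identically_distributed (R : realType) (d d' : measure_display)
    (T : measurableType d) (T' : measurableType d') (Pr : probability T R)
    (I : Type) (X : I -> {RV Pr >-> T'}) : Prop :=
  forall (i j : I) (B : set T'), measurable B ->
    distribution Pr (X i) B = distribution Pr (X j) B.

Definition prob (R : realType) (d : measure_display) (T : measurableType d)
  (Pr : probability T R) (E : set T) : R := fine (Pr E).

Definition mx_expectation (R : realType) (d : measure_display)
    (T : measurableType d) (Pr : probability T R) (N : nat) (X : T -> 'M[R]_N) :
    'M[R]_N :=
  \matrix_(i, j) fine ('E_Pr[fun w => X w i j])%E.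

Definition psi_gf (R : realType) (psi : nat -> R) (u : cplx R) : cplx R :=
  limn (fun n => \sum_(1 <= r < n) to_cplx (psi r) * u ^+ r).

Definition psi_gf_mx (R : realType) (N : nat) (psi : nat -> R)
    (M : 'M[cplx R]_N) : 'M[cplx R]_N :=
  limn (fun n => \sum_(1 <= r < n) to_cplx (psi r) *: M ^+ r).

Definition Phi0 (R : realType) (psi : nat -> R) (t : nat) : R :=
  limn (fun n => \sum_(t.+1 <= r < n) psi r).

(* In what follows [dt n] is the (n+1)-st waiting time [Delta t_(n+1)]. *)

Definition waiting_law (R : realType) (d : measure_display)
    (T : measurableType d) (Pr : probability T R) (dt : nat -> {RV Pr >-> nat})
    (r : nat) : R :=
  prob Pr [set w | dt 0%N w = r].

Definition reset_time (R : realType) (d : measure_display)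
    (T : measurableType d) (Pr : probability T R) (dt : nat -> {RV Pr >-> nat})
    (n : nat) (w : T) : nat :=
  (\sum_(i < n) dt i w)%N.

(* The largest [n] with [J_n <= t]; it exists because the waiting times are
   positive and [J_0 = 0]. *)
Definition reset_count (R : realType) (d : measure_display)
    (T : measurableType d) (Pr : probability T R) (dt : nat -> {RV Pr >-> nat})
    (t : nat) (w : T) : nat :=
  get [set n | (reset_time dt n w <= t)%N /\
               forall m, (reset_time dt m w <= t)%N -> (m <= n)%N].

Definition backward_time (R : realType) (d : measure_display)
    (T : measurableType d) (Pr : probability T R) (dt : nat -> {RV Pr >-> nat})
    (t : nat) (w : T) : nat :=
  (t - reset_time dt (reset_count dt t w) w)%N.

Definition backward_law (R : realType) (d : measure_display)
    (T : measurableType d) (Pr : probability T R) (dt : nat -> {RV Pr >-> nat})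
    (t b : nat) : R :=
  prob Pr [set w | backward_time dt t w = b].

(* Defined on [int], since it is evaluated at [t - b] with possibly [b > t]. *)
Definition reset_rate (R : realType) (d : measure_display)
    (T : measurableType d) (Pr : probability T R) (dt : nat -> {RV Pr >-> nat})
    (t : int) : R :=
  if 0 < t then
    limn (fun m => \sum_(1 <= n < m) prob Pr [set w | (reset_time dt n w)%:Z = t])
  else 0.

Definition Theta (R : realType) (a t b : nat) : R := (a <= t <= b - 1)%N%:R.

(* On the event [J_n > t], where [t - J_n] is truncated to 0, [Theta] is 0. *)
Definition propagator (R : realType) (d : measure_display)
    (T : measurableType d) (Pr : probability T R) (dt : nat -> {RV Pr >-> nat})
    (N : nat) (W Rel : 'M[R]_N) (t : nat) : 'M[R]_N :=
  let J := reset_time dt in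
  fine ('E_Pr[fun w => Theta R (J 0%N w) t (J 1%N w)])%E *: W ^+ t
  + Rel *m limn (fun m => \sum_(1 <= n < m)
      mx_expectation Pr
        (fun w => Theta R (J n w) t (J n.+1 w) *: W ^+ (t - J n w))).

Definition propagator_gf_partial (R : realType) (N : nat) (P : nat -> 'M[R]_N)
    (u : cplx R) (n : nat) : 'M[cplx R]_N :=
  \sum_(0 <= t < n) u ^+ t *: to_cplx_mx (P t).

Definition propagator_gf (R : realType) (N : nat) (P : nat -> 'M[R]_N)
    (u : cplx R) : 'M[cplx R]_N :=
  limn (propagator_gf_partial P u).

(* Main.v *)
Require Import Defs.
From HB Require Import structures.
From mathcomp Require Import all_boot all_order all_algebra finmap.
From mathcomp Require Import complex ring.
From mathcomp Require Import all_classical all_reals all_analysis.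

Set Implicit Arguments.
Unset Strict Implicit.
Unset Printing Implicit Defensive.
Import Order.TTheory GRing.Theory Num.Theory.
Import numFieldNormedType.Exports.

Local Open Scope classical_set_scope.
Local Open Scope ring_scope.

(** The probability that J_n = t - b and Delta t_(n+1) > b factorizes as
    P[J_n = t - b] * Phi0 b, since J_n only depends on the first n waiting
    times; summing over n gives the law of the
    backward recurrence time and P(t).  The renewal equation for P follows from
    the one for the reset rate, obtained by splitting J_(n+1) according to its
    last increment, together with Rel^2 = Rel.  For the generating function
    Pbar, put G = sum_t Phi0 t (uW)^t.  The renewal equation reads
    Pbar = G + psi(u) Rel Pbar, whence Rel Pbar = Rel G / (1 - psi(u)), and
    telescoping gives G (1 - uW) = 1 - psi(uW).  Every series involved is
    entrywise a power series with bounded real coefficients. *)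

HB.instance Definition _ (R : realType) :=
  GRing.RMorphism.copy (@to_cplx R) (real_complex R).

(** * Limits of matrix sequences, taken entrywise *)

Section MatrixLimits.
Variables (K : numFieldType) (m n : nat).
Implicit Types (u : nat -> 'M[K]_(m, n)) (M : 'M[K]_(m, n)).

(** A neighbourhood of [M] contains a product of neighbourhoods of its entries. There are finitely
    many entries, so eventually all of them are in place at once. *)
Lemma cvgn_mxP u M :
  u @ \oo --> M <-> forall i j, (fun k => u k i j) @ \oo --> M i j.
Proof.
split=> [uM i j|uM A [P MP PA]].
  apply: (cvg_comp u (fun M : 'M[K]_(m, n) => M i j) uM).
  exact: coord_continuous.
have uP : \forall k \near \oo, forall i j, P i j (u k i j).
  by do 2 (apply: filter_forall => ?); exact/uM/MP.
by apply: filterS uP => k Pk; exact: PA.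
Qed.

Lemma limn_mx u M : u @ \oo --> M -> limn u = M.
Proof.
move=> uM; have /cvgn_mxP uL := cvgP _ uM; have /cvgn_mxP {}uM := uM.
by apply/matrixP => i j; apply: (cvg_unique _ (uL i j) (uM i j)).
Qed.

End MatrixLimits.

Lemma cvgn_mulmx (K : numFieldType) (m n p : nat) (A : 'M[K]_(m, n))
    (u : nat -> 'M[K]_(n, p)) (M : 'M[K]_(n, p)) :
  u @ \oo --> M -> (fun k => A *m u k) @ \oo --> A *m M.
Proof.
move=> /cvgn_mxP uM; apply/cvgn_mxP => i j.
under eq_fun do rewrite mxE; rewrite mxE.
apply: cvg_big => [|k _]; first exact: add_continuous.
by apply: cvgM; [exact: cvg_cst|exact: uM].
Qed.

Lemma cvgn_mulmxr (K : numFieldType) (m n p : nat) (A : 'M[K]_(n, p))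
    (u : nat -> 'M[K]_(m, n)) (M : 'M[K]_(m, n)) :
  u @ \oo --> M -> (fun k => u k *m A) @ \oo --> M *m A.
Proof.
move=> /cvgn_mxP uM; apply/cvgn_mxP => i j.
under eq_fun do rewrite mxE; rewrite mxE.
apply: cvg_big => [|k _]; first exact: add_continuous.
by apply: cvgM; [exact: uM|exact: cvg_cst].
Qed.

(** * Complex power series with bounded real coefficients, and their Cauchy product *)

Section ComplexSeries.
Variable R : realType.
Implicit Types (a b c : nat -> R) (u z : cplx R) (x r C : R).

Lemma to_cplx_norm x : `|to_cplx x| = to_cplx `|x|.
Proof.
by rewrite /to_cplx normc_def /= expr0n addr0 sqrtr_sqr.
Qed.

(** The modulus takes values in [cplx R]. Its real part is the same number inside [R], where the
    order is total and real estimates apply. *)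
Lemma cplx_normE z : `|z| = to_cplx (complex.Re `|z|).
Proof. by rewrite normc_def. Qed.

Lemma Re_norm_ge0 z : 0 <= complex.Re `|z|.
Proof. by rewrite normc_def sqrtr_ge0. Qed.

Lemma normr_Re_le z : `|complex.Re z| <= complex.Re `|z|.
Proof.
by rewrite normc_def /= -sqrtr_sqr ler_wsqrtr// lerDl sqr_ge0.
Qed.

Lemma normr_Im_le z : `|complex.Im z| <= complex.Re `|z|.
Proof.
by rewrite normc_def /= -sqrtr_sqr ler_wsqrtr// lerDr sqr_ge0.
Qed.

Lemma to_cplx_le x r : (to_cplx x <= to_cplx r) = (x <= r).
Proof. exact: lecR. Qed.

Lemma to_cplx_lt x r : (to_cplx x < to_cplx r) = (x < r).
Proof. exact: ltcR. Qed.

Lemma Re_norm_lt1 z : `|z| < 1 -> complex.Re `|z| < 1.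
Proof. by rewrite {1}cplx_normE -(rmorph1 (@to_cplx R)) to_cplx_lt. Qed.

Lemma cvg_to_cplx (x_ : nat -> R) x :
  x_ @ \oo --> x -> (fun n => to_cplx (x_ n)) @ \oo --> to_cplx x.
Proof.
move=> /cvgrPdist_lt xx; apply/cvgrPdist_lt => e e0.
(* A positive element of [cplx R] is real, so the tolerance can be moved to [R]. *)
have eE : e = to_cplx (complex.Re e).
  by rewrite -[in LHS](gtr0_norm e0) cplx_normE (gtr0_norm e0).
have re0 : 0 < complex.Re e by rewrite -to_cplx_lt rmorph0 -eE.
near=> n; rewrite -rmorphB to_cplx_norm eE to_cplx_lt.
by near: n; exact: xx.
Unshelve. all: by end_near. Qed.

Lemma squeeze_cplx0 (z_ : nat -> cplx R) (x_ : nat -> R) :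
  (forall n, `|z_ n| <= to_cplx (x_ n)) -> x_ @ \oo --> (0 : R) ->
  z_ @ \oo --> (0 : cplx R).
Proof.
move=> zx /cvg_to_cplx /cvgrPdist_lt; rewrite rmorph0 => x0.
apply/cvgr0Pnorm_lt => e e0; near=> n.
apply: le_lt_trans (zx n) _.
rewrite -(ger0_norm (le_trans (normr_ge0 _) (zx n))) -normrN -sub0r.
by near: n; exact: x0.
Unshelve. all: by end_near. Qed.

(** This reduces the existence of a complex limit to the completeness of [R]. *)
Lemma cvg_to_cplx_Re_Im (z_ : nat -> cplx R) :
  cvgn (fun n => complex.Re (z_ n)) -> cvgn (fun n => complex.Im (z_ n)) ->
  cvgn z_.
Proof.
move=> /cvg_to_cplx cr /cvg_to_cplx ci.
have -> : z_ = fun n => to_cplx (complex.Re (z_ n)) +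
    ('i%C : cplx R) * to_cplx (complex.Im (z_ n)).
  by apply/funext => n; rewrite [LHS]complexE.
apply: (cvgP (_ + ('i%C : cplx R) * _)); apply: cvgD cr _.
by apply: cvgM ci; exact: cvg_cst.
Qed.

Lemma is_cvg_series_geo_bound a C r : (forall n, `|a n| <= C * r ^+ n) ->
  0 <= r < 1 -> cvgn (fun n => \sum_(0 <= t < n) a t).
Proof.
move=> aC /andP[r0 r1]; apply: (@normed_cvg _ R^o).
apply: (@series_le_cvg _ _ (geometric C r)) => // [n|n|].
- exact: normr_ge0.
- exact: le_trans (aC n).
- by apply: is_cvg_geometric_series; rewrite ger0_norm.
Qed.

Lemma is_cvg_power_series c C u : (forall t, `|c t| <= C) -> `|u| < 1 ->
  cvgn (fun n => \sum_(0 <= t < n) to_cplx (c t) * u ^+ t).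
Proof.
move=> cC u1.
have u01 : 0 <= complex.Re `|u| < 1 by rewrite Re_norm_ge0 Re_norm_lt1.
have bound t : complex.Re `|to_cplx (c t) * u ^+ t| <= C * complex.Re `|u| ^+ t.
  rewrite -to_cplx_le -cplx_normE normrM normrX rmorphM rmorphXn /=.
  by rewrite -cplx_normE ler_wpM2r ?exprn_ge0// to_cplx_norm to_cplx_le.
apply: cvg_to_cplx_Re_Im.
- under eq_fun do rewrite (raddf_sum (@complex.Re R)).
  apply: is_cvg_series_geo_bound u01 => t.
  exact: le_trans (normr_Re_le _) (bound t).
- under eq_fun do rewrite (raddf_sum (@complex.Im R)).
  apply: is_cvg_series_geo_bound u01 => t.
  exact: le_trans (normr_Im_le _) (bound t).
Qed.

Lemma cvg_natmul_exprn r : 0 <= r < 1 ->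
  (fun n => n%:R * r ^+ n) @ \oo --> (0 : R).
Proof.
move=> /andP[r0 r1]; pose s := Num.sqrt r.
have s0 : 0 <= s by exact: sqrtr_ge0.
have s1 : s < 1 by rewrite -sqrtr1 ltr_sqrt.
(* [r ^+ n = s ^+ n * s ^+ n], and [n * s ^+ n] stays below the geometric sum. *)
have nsn n : n%:R * s ^+ n <= (1 - s)^-1.
  rewrite -[leRHS]mul1r ler_pdivlMr ?subr_gt0//.
  apply: (@le_trans _ _ ((1 - s) * \sum_(i < n) s ^+ i)).
    rewrite mulrC ler_wpM2l ?subr_ge0 ?(ltW s1)//.
    rewrite -[n in n%:R]card_ord mulr_natl -sumr_const; apply: ler_sum => i _.
    by apply: ler_wiXn2l; [|exact: ltW|exact: ltnW].
  by rewrite -opprB mulNr -subrX1 opprB gerBl exprn_ge0.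
apply: (@squeeze_cvgr _ _ _ _ (cst 0) (geometric (1 - s)^-1 s)).
- apply: nearW => n; rewrite mulr_ge0 ?exprn_ge0//=.
  rewrite -(sqr_sqrtr r0) -/s -exprM mulnC exprM expr2 mulrA.
  by rewrite ler_wpM2r ?exprn_ge0.
- exact: cvg_cst.
- by apply: cvg_geometric; rewrite ger0_norm.
Qed.

Lemma sum_geometric_le m n r : 0 <= r < 1 ->
  \sum_(m <= j < n) r ^+ j <= r ^+ m / (1 - r).
Proof.
move=> /andP[r0 r1]; have [mn|nm] := leqP m n; last first.
  by rewrite big_geq ?(ltnW nm)// divr_ge0 ?exprn_ge0// subr_ge0 ltW.
rewrite ler_pdivlMr ?subr_gt0// mulr_suml.
under eq_bigr do rewrite mulrBr mulr1 -exprSr -opprB.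
by rewrite sumrN telescope_sumr// opprB gerBl exprn_ge0.
Qed.

(** Both sides sum over the triangle [k + j < n]. Passing to [n + 1] adds the antidiagonal
    [k + j = n], which lengthens each inner sum on the right by one term. *)
Lemma sum_cauchy_product (K : pzRingType) (f g : nat -> K) n :
  \sum_(0 <= t < n) \sum_(0 <= k < t.+1) f k * g (t - k)%N =
  \sum_(0 <= k < n) f k * \sum_(0 <= j < n - k) g j.
Proof.
elim: n => [|n IH]; first by rewrite !big_geq.
rewrite big_nat_recr//= {}IH [RHS]big_nat_recr//= [in RHS]subSnn big_nat1.
rewrite [X in _ + X]big_nat_recr//= subnn addrA; congr (_ + _).
rewrite -big_split/=; apply: eq_big_nat => k /andP[_ kn].
by rewrite subSn 1?ltnW// big_nat_recr//= mulrDr.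
Qed.

(** The partial sum of the product series is the product of the partial sums minus the terms with
    [k, j < n <= k + j]. With [r] the modulus of [u], each [k] contributes at most
    [C * C / (1 - r) * r ^+ n] to this corner, so the corner is of order [n * r ^+ n] and vanishes
    in the limit. *)
Lemma cvg_cauchy_product a b C u (za zb : cplx R) :
    (forall t, `|a t| <= C) -> (forall t, `|b t| <= C) -> `|u| < 1 ->
    (fun n => \sum_(0 <= t < n) to_cplx (a t) * u ^+ t) @ \oo --> za ->
    (fun n => \sum_(0 <= t < n) to_cplx (b t) * u ^+ t) @ \oo --> zb ->
  (fun n => \sum_(0 <= t < n)
    to_cplx (\sum_(0 <= k < t.+1) a k * b (t - k)%N) * u ^+ t) @ \oo --> za * zb.
Proof.
move=> aC bC u1 cva cvb.
have u01 : 0 <= complex.Re `|u| < 1 by rewrite Re_norm_ge0 Re_norm_lt1.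
have [u0 {}u1] := andP u01.
set r := complex.Re `|u| in u0 u1 u01.
have C0 : 0 <= C by exact: le_trans (aC 0%N).
have -> : (fun n => \sum_(0 <= t < n)
    to_cplx (\sum_(0 <= k < t.+1) a k * b (t - k)%N) * u ^+ t) =
  (fun n => (\sum_(0 <= t < n) to_cplx (a t) * u ^+ t) *
            (\sum_(0 <= t < n) to_cplx (b t) * u ^+ t)
    - \sum_(0 <= k < n) (to_cplx (a k) * u ^+ k) *
       \sum_((n - k)%N <= j < n) to_cplx (b j) * u ^+ j).
  apply/funext => n; rewrite mulr_suml -sumrB.
  under [RHS]eq_bigr do rewrite -mulrBr.
  transitivity (\sum_(0 <= t < n) \sum_(0 <= k < t.+1)
     (to_cplx (a k) * u ^+ k) * (to_cplx (b (t - k)%N) * u ^+ (t - k))).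
    apply: eq_bigr => t _; rewrite rmorph_sum mulr_suml.
    apply: eq_big_nat => k /andP[_ kt].
    by rewrite rmorphM/= mulrACA -exprD subnKC.
  rewrite (sum_cauchy_product (fun k => to_cplx (a k) * u ^+ k)
    (fun k => to_cplx (b k) * u ^+ k)); apply: eq_bigr => k _.
  by rewrite [in RHS](big_cat_nat (n := (n - k)%N))//= ?leq_subr// addrK.
rewrite -(subr0 (za * zb)); apply: cvgB (cvgM cva cvb) _.
apply: (@squeeze_cplx0 _ (fun n => C * C / (1 - r) * (n%:R * r ^+ n))).
  move=> n; apply: le_trans (ler_norm_sum _ _ _) _.
  have -> : C * C / (1 - r) * (n%:R * r ^+ n) =
            \sum_(0 <= k < n) C * C / (1 - r) * r ^+ n.
    by rewrite sumr_const_nat subn0 -mulrnAr mulr_natl.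
  rewrite rmorph_sum/=; apply: ler_sum_nat => k /andP[_ kn].
  have -> : C * C / (1 - r) * r ^+ n = (C * r ^+ k) * (C * (r ^+ (n - k) / (1 - r))).
    by rewrite -[in LHS](subnKC (ltnW kn)) exprD; ring.
  rewrite rmorphM normrM /=; apply: ler_pM => //.
    rewrite normrM normrX rmorphM rmorphXn/= -cplx_normE to_cplx_norm.
    by rewrite ler_wpM2r ?exprn_ge0// to_cplx_le.
  apply: le_trans (ler_norm_sum _ _ _) _.
  apply: (@le_trans _ _ (to_cplx (C * \sum_((n - k)%N <= j < n) r ^+ j))).
    rewrite mulr_sumr rmorph_sum/=; apply: ler_sum => j _.
    rewrite normrM normrX rmorphM rmorphXn/= -cplx_normE to_cplx_norm.
    by rewrite ler_wpM2r ?exprn_ge0// to_cplx_le.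
  by rewrite to_cplx_le ler_wpM2l// sum_geometric_le.
rewrite -(mulr0 (C * C / (1 - r))).
by apply: cvgM; [exact: cvg_cst|exact: cvg_natmul_exprn].
Qed.

End ComplexSeries.

(** * Row-stochastic matrices *)

Definition row_stochastic (R : numDomainType) (m n : nat) (A : 'M[R]_(m, n)) :=
  (forall i j, 0 <= A i j) /\ forall i, \sum_j A i j = 1.

Section RowStochastic.
Variable R : numFieldType.

Lemma row_stochastic_mul m n p (A : 'M[R]_(m, n)) (B : 'M[R]_(n, p)) :
  row_stochastic A -> row_stochastic B -> row_stochastic (A *m B).
Proof.
move=> [A0 A1] [B0 B1]; split=> [i j|i].
  by rewrite mxE sumr_ge0// => k _; rewrite mulr_ge0.
under eq_bigr do rewrite mxE.
rewrite exchange_big/= -[RHS](A1 i); apply: eq_bigr => k _.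
by rewrite -mulr_sumr B1 mulr1.
Qed.

Lemma row_stochastic_exp n (A : 'M[R]_n) t :
  row_stochastic A -> row_stochastic (A ^+ t).
Proof.
move=> sA; elim: t => [|t IH]; last by rewrite exprS; exact: row_stochastic_mul.
split=> [i j|i]; rewrite expr0; first by rewrite mxE ler0n.
under eq_bigr do rewrite mxE.
by rewrite (bigD1 i)//= eqxx big1 ?addr0// => j /negPf; rewrite eq_sym => ->.
Qed.

Lemma row_stochastic_le1 m n (A : 'M[R]_(m, n)) i j :
  row_stochastic A -> A i j <= 1.
Proof.
move=> [A0 A1]; rewrite -(A1 i) (bigD1 j)//= lerDl.
by apply: sumr_ge0 => k _.
Qed.

End RowStochastic.

(** Consecutive tails [1 - \sum_(0 <= r < t.+1) a r] differ by [a t], so Abel summation turns the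
    product into the series of [a]. The boundary terms are the empty tail 1 and the last tail times
    [X ^+ m]. *)
Lemma telescope_tail_mx (K : comPzRingType) (n : nat) (X : 'M[K]_n)
    (a : nat -> K) m :
  (\sum_(0 <= t < m) (1 - \sum_(0 <= r < t.+1) a r) *: X ^+ t) *m (1%:M - X) =
  1%:M - \sum_(0 <= r < m) a r *: X ^+ r - (1 - \sum_(0 <= r < m) a r) *: X ^+ m.
Proof.
elim: m => [|m IH].
  by rewrite !big_geq// mul0mx !subr0 scale1r expr0 subrr.
rewrite big_nat_recr//= mulmxDl IH [in RHS]big_nat_recr//=.
have tailS : 1 - \sum_(0 <= r < m.+1) a r = 1 - \sum_(0 <= r < m) a r - a m.
  by rewrite big_nat_recr//= opprD addrA.
rewrite mulmxBr mulmx1 -[in X in _ + (_ - X)]scalemxAl mulmxE -exprSr !tailS.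
by rewrite [in X in _ + (X - _)]scalerBl !addrA subrK opprD addrA.
Qed.

(** * Generating function of any matrix sequence solving the renewal equation *)

Section GeneratingFunction.
Variables (R : realType) (N : nat) (W Rel : 'M[R]_N).
Variables (psi : nat -> R) (P : nat -> 'M[R]_N).
Hypotheses (W_stoch : row_stochastic W) (Rel_stoch : row_stochastic Rel).
Hypothesis Rel_idem : Rel *m Rel = Rel.
Hypotheses (psi0 : psi 0%N = 0) (psi_ge0 : forall r, 0 <= psi r).
Hypothesis psi_sum : forall n, \sum_(0 <= r < n) psi r <= 1.
Let Phi t := 1 - \sum_(0 <= r < t.+1) psi r.
Hypothesis P_renewal : forall t, P t = Phi t *: W ^+ t +
  Rel *m \sum_(1 <= k < t.+1) psi k *: P (t - k)%N.

Let psi_le1 r : psi r <= 1.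
Proof.
apply: le_trans (psi_sum r.+1); rewrite big_nat_recr//= lerDr.
by rewrite sumr_ge0.
Qed.

Let Phi_ge0 t : 0 <= Phi t. Proof. by rewrite subr_ge0. Qed.

Let Phi_le1 t : Phi t <= 1. Proof. by rewrite gerBl sumr_ge0. Qed.

Let Q t := Rel *m P t.

(** Since [psi 0 = 0], the sum may start at 0; it is then a full convolution, the form required by
    the Cauchy product. *)
Let P_entry t i j : P t i j =
  Phi t * (W ^+ t) i j + \sum_(0 <= k < t.+1) psi k * Q (t - k)%N i j.
Proof.
rewrite P_renewal mxE mxE; congr (_ + _).
rewrite mulmx_sumr summxE [RHS]big_ltn// psi0 mul0r add0r.
by apply: eq_bigr => k _; rewrite -scalemxAr mxE.
Qed.

(** By strong induction, the renewal equation combines quantities bounded by 1 with the weights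
    [Phi t] and [psi k], which add up to 1. *)
Let P_bounded t i j : `|P t i j| <= 1.
Proof.
elim/ltn_ind: t i j => t IH i j; rewrite P_entry.
rewrite (le_trans (ler_normD _ _))//.
have -> : 1 = Phi t + \sum_(0 <= k < t.+1) psi k :> R by rewrite subrK.
have [Wt0 _] := row_stochastic_exp t W_stoch.
apply: lerD.
  rewrite ger0_norm ?mulr_ge0// ler_piMr//.
  exact/row_stochastic_le1/row_stochastic_exp.
apply: le_trans (ler_norm_sum _ _ _) _; apply: ler_sum_nat => -[|k] /andP[_ kt].
  (* At [k = 0] the induction hypothesis would be needed at [t] itself; the weight vanishes
     there. *)
  by rewrite psi0 mul0r normr0.
rewrite normrM ger0_norm// ler_piMr// mxE.
have [Rel0 Rel1] := Rel_stoch; rewrite -(Rel1 i).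
apply: le_trans (ler_norm_sum _ _ _) _; apply: ler_sum => l _.
rewrite normrM ger0_norm// ler_piMr// IH// ltn_subrL.
by rewrite (leq_trans _ (kt : (k < t)%N)).
Qed.

Let Q_bounded t i j : `|Q t i j| <= 1.
Proof.
rewrite mxE; have [Rel0 Rel1] := Rel_stoch; rewrite -(Rel1 i).
apply: le_trans (ler_norm_sum _ _ _) _; apply: ler_sum => l _.
by rewrite normrM ger0_norm// ler_piMr.
Qed.

Variable u : cplx R.
Hypothesis u1 : `|u| < 1.

Let Wc := to_cplx_mx W.
Let Relc := to_cplx_mx Rel.

Let to_cplx_mxX t : to_cplx_mx (W ^+ t) = Wc ^+ t.
Proof.
elim: t => [|t IH]; first by rewrite !expr0 /to_cplx_mx map_mx1.
by rewrite !exprS -IH /Wc /to_cplx_mx map_mxM.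
Qed.

Let scaled_exp t : (u *: Wc) ^+ t = u ^+ t *: Wc ^+ t.
Proof.
elim: t => [|t IH]; first by rewrite !expr0 scale1r.
by rewrite !exprS IH -!mulmxE -scalemxAl -scalemxAr scalerA.
Qed.

(* A row vector in the kernel satisfies [v = u *: (v *m Wc)], which contracts the
   l1 norm. *)
Lemma unitmx_1_sub_walk : 1%:M - u *: Wc \in unitmx.
Proof.
rewrite -row_free_unit; apply: inj_row_free => v.
rewrite mulmxBr mulmx1 -scalemxAr => /eqP; rewrite subr_eq0 => /eqP vE.
have [W0 W1] := W_stoch.
have vle : \sum_j `|v 0 j| <= `|u| * \sum_j `|v 0 j|.
  have -> : `|u| * \sum_j `|v 0 j| =
      \sum_j `|u| * \sum_k `|v 0 k| * Wc k j.
    rewrite -mulr_sumr exchange_big/=; congr (_ * _); apply: eq_bigr => k _.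
    rewrite -mulr_sumr.
    have -> : \sum_j Wc k j = to_cplx (\sum_j W k j).
      by rewrite rmorph_sum; apply: eq_bigr => j _; rewrite mxE.
    by rewrite W1 rmorph1 mulr1.
  apply: ler_sum => j _; rewrite {1}vE mxE normrM ler_wpM2l// mxE.
  apply: le_trans (ler_norm_sum _ _ _) _; apply: ler_sum => k _.
  by rewrite normrM mxE to_cplx_norm (ger0_norm (W0 _ _)).
have v0 : \sum_j `|v 0 j| = 0.
  apply/eqP; rewrite eq_le sumr_ge0 ?andbT//.
  rewrite -(pmulr_rle0 _ (_ : 0 < 1 - `|u|)) ?subr_gt0//.
  by rewrite mulrBl mul1r subr_le0.
apply/rowP => j; rewrite mxE; apply/normr0_eq0.
by apply: (psumr_eq0P _ v0).
Qed.

Let psi_from0 n :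
  \sum_(1 <= r < n) to_cplx (psi r) * u ^+ r =
  \sum_(0 <= r < n) to_cplx (psi r) * u ^+ r.
Proof.
case: n => [|n]; first by rewrite !big_geq.
by rewrite [RHS]big_ltn// psi0 rmorph0 mul0r add0r.
Qed.

Lemma cvg_psi_gf :
  (fun n => \sum_(1 <= r < n) to_cplx (psi r) * u ^+ r) @ \oo --> psi_gf psi u.
Proof.
have : cvgn (fun n => \sum_(1 <= r < n) to_cplx (psi r) * u ^+ r).
  under eq_fun do rewrite psi_from0.
  by apply: (@is_cvg_power_series _ _ 1) => // t; rewrite ger0_norm.
exact.
Qed.

Let psi_mx_from0 n :
  \sum_(1 <= r < n) to_cplx (psi r) *: (u *: Wc) ^+ r =
  \sum_(0 <= r < n) to_cplx (psi r) *: (u *: Wc) ^+ r.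
Proof.
case: n => [|n]; first by rewrite !big_geq.
by rewrite [RHS]big_ltn// psi0 rmorph0 scale0r add0r.
Qed.

Let psi_mx_entry n i j :
  (\sum_(1 <= r < n) to_cplx (psi r) *: (u *: Wc) ^+ r) i j =
  \sum_(0 <= r < n) to_cplx (psi r * (W ^+ r) i j) * u ^+ r.
Proof.
rewrite psi_mx_from0 summxE; apply: eq_bigr => r _.
by rewrite scaled_exp -to_cplx_mxX !mxE rmorphM/= mulrA mulrAC.
Qed.

(** Entrywise this is a power series in [u] whose coefficients [psi r * (W ^+ r) i j] lie between 0
    and 1. *)
Lemma cvg_psi_gf_mx :
  (fun n => \sum_(1 <= r < n) to_cplx (psi r) *: (u *: Wc) ^+ r) @ \oo -->
  psi_gf_mx psi (u *: Wc).
Proof.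
pose L := \matrix_(i, j)
  limn (fun n => \sum_(0 <= r < n) to_cplx (psi r * (W ^+ r) i j) * u ^+ r).
have cL : (fun n => \sum_(1 <= r < n) to_cplx (psi r) *: (u *: Wc) ^+ r)
    @ \oo --> L.
  apply/cvgn_mxP => i j; under eq_fun do rewrite psi_mx_entry.
  rewrite mxE; apply: (@is_cvg_power_series _ _ 1) => // t.
  have [Wt0 _] := row_stochastic_exp t W_stoch.
  rewrite ger0_norm ?mulr_ge0// mulr_ile1//.
  exact/row_stochastic_le1/row_stochastic_exp.
by rewrite /psi_gf_mx (limn_mx cL).
Qed.

(** For [r >= 1] the modulus of [u ^+ r] is at most that of [u], so every partial sum has modulus at
    most that of [u]. The partial sums thus keep a fixed positive distance from 1. *)
Lemma psi_gf_neq1 : 1 - psi_gf psi u != 0.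
Proof.
rewrite subr_eq0; apply/eqP => psi1.
have /cvgrPdist_lt/(_ (1 - `|u|)) := cvg_psi_gf.
rewrite subr_gt0 -psi1 => /(_ u1) [n _ /(_ n (leqnn n))]; apply/negP.
rewrite /= -real_leNgt ?rpredB ?normr_real ?rpred1//.
apply: le_trans (lerB_dist _ _); rewrite normr1 lerB//.
apply: le_trans (ler_norm_sum _ _ _) _.
apply: (@le_trans _ _ (\sum_(1 <= r < n) to_cplx (psi r) * `|u|)).
  apply: ler_sum_nat => -[//|r] _.
  rewrite normrM normrX to_cplx_norm (ger0_norm (psi_ge0 _)) ler_wpM2l//.
    by rewrite -(rmorph0 (@to_cplx R)) to_cplx_le.
  by rewrite exprS ler_piMr// exprn_ile1// ltW.
rewrite -mulr_suml ler_piMl// -rmorph_sum -(rmorph1 (@to_cplx R)) to_cplx_le.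
apply: le_trans (psi_sum n); case: n => [|n]; first by rewrite !big_geq.
by rewrite [leRHS]big_ltn// psi0 add0r.
Qed.

(** By [P_bounded], every entry is a power series with coefficients bounded by 1. *)
Lemma cvg_propagator_gf :
  propagator_gf_partial P u @ \oo --> propagator_gf P u.
Proof.
pose L := \matrix_(i, j)
  limn (fun n => \sum_(0 <= t < n) to_cplx (P t i j) * u ^+ t).
have cL : propagator_gf_partial P u @ \oo --> L.
  apply/cvgn_mxP => i j.
  rewrite /propagator_gf_partial; under eq_fun do rewrite summxE.
  under eq_fun do under eq_bigr do rewrite !mxE mulrC.
  by rewrite mxE; exact: (@is_cvg_power_series _ _ 1).
by rewrite /propagator_gf (limn_mx cL).
Qed.

Let G_ n : 'M[cplx R]_N :=
  \sum_(0 <= t < n) (to_cplx (Phi t) * u ^+ t) *: Wc ^+ t.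

(** The renewal equation, solved for its [Phi] term, expresses [G_ n] as a partial sum of the
    generating function of [P] minus one of the convolution of [psi] and [Q]. The latter converges
    by the Cauchy product, so [G_] needs no separate convergence argument. *)
Let cvg_G : G_ @ \oo --> propagator_gf P u
  - psi_gf psi u *: (Relc *m propagator_gf P u).
Proof.
have /cvgn_mxP cP := cvg_propagator_gf.
have /cvgn_mxP cQ := cvgn_mulmx (A := Relc) cvg_propagator_gf.
apply/cvgn_mxP => i j; rewrite 3!mxE.
have := @cvg_cauchy_product R psi (fun t => Q t i j) 1 u (psi_gf psi u)
  ((Relc *m propagator_gf P u) i j).
move=> /(_ _ _ u1); have psib t : `|psi t| <= 1 by rewrite ger0_norm.
move=> /(_ psib (fun t => Q_bounded t i j)).
have -> : (fun n => \sum_(0 <= t < n) to_cplx (psi t) * u ^+ t) =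
          (fun n => \sum_(1 <= r < n) to_cplx (psi r) * u ^+ r).
  by apply/funext => n; rewrite psi_from0.
move=> /(_ cvg_psi_gf).
have -> : (fun n => \sum_(0 <= t < n) to_cplx (Q t i j) * u ^+ t) =
          (fun n => (Relc *m propagator_gf_partial P u n) i j).
  apply/funext => n; rewrite mulmx_sumr summxE; apply: eq_bigr => t _.
  have QE : Relc *m to_cplx_mx (P t) = to_cplx_mx (Q t).
    by rewrite /Relc /to_cplx_mx -map_mxM.
  by rewrite -scalemxAr QE [RHS]mxE [X in _ = _ * X]mxE mulrC.
move=> /(_ (cQ i j)) cQij.
have -> : (fun n => G_ n i j) = (fun n => propagator_gf_partial P u n i j -
    \sum_(0 <= t < n)
      to_cplx (\sum_(0 <= k < t.+1) psi k * Q (t - k)%N i j) * u ^+ t).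
  apply/funext => n; rewrite /G_ /propagator_gf_partial !summxE -sumrB.
  apply: eq_bigr => t _; rewrite !mxE P_entry -to_cplx_mxX mxE.
  move: (Phi t) (\sum_(0 <= k < t.+1) _) => p s.
  by rewrite rmorphD rmorphM/=; ring.
exact: (cvgB (cP i j) cQij).
Qed.

Let G_mul n : G_ n *m (1%:M - u *: Wc) =
  1%:M - \sum_(1 <= r < n) to_cplx (psi r) *: (u *: Wc) ^+ r
  - to_cplx (1 - \sum_(0 <= r < n) psi r) *: (u *: Wc) ^+ n.
Proof.
have toE m : to_cplx (1 - \sum_(0 <= r < m) psi r) =
    1 - \sum_(0 <= r < m) to_cplx (psi r).
  by rewrite rmorphB rmorph1 rmorph_sum.
have -> : G_ n = \sum_(0 <= t < n)
    (1 - \sum_(0 <= r < t.+1) to_cplx (psi r)) *: (u *: Wc) ^+ t.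
  by apply: eq_bigr => t _; rewrite scaled_exp scalerA -toE.
rewrite psi_mx_from0 toE; exact: telescope_tail_mx.
Qed.

(** The boundary term left by telescoping is bounded entrywise by the [n]-th power of the modulus of
    [u], because both the tail of [psi] and the entries of [W ^+ n] are at most 1. *)
Let cvg_G_mul : (fun n => G_ n *m (1%:M - u *: Wc)) @ \oo -->
  1%:M - psi_gf_mx psi (u *: Wc).
Proof.
have /cvgn_mxP cM := cvg_psi_gf_mx.
have mxB (A B : 'M[cplx R]_N) i j : (A - B) i j = A i j - B i j.
  by rewrite mxE [X in _ + X]mxE.
apply/cvgn_mxP => i j; under eq_fun do rewrite G_mul !mxB.
rewrite mxB -[_ - psi_gf_mx _ _ _ _]subr0.
apply: cvgB; first by apply: cvgB; [exact: cvg_cst|exact: cM].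
apply: (@squeeze_cplx0 _ _ (geometric 1 (complex.Re `|u|))) => [n|]; last first.
  by apply: cvg_geometric; rewrite ger0_norm ?Re_norm_ge0// Re_norm_lt1.
rewrite scaled_exp -to_cplx_mxX !mxE !normrM normrX !to_cplx_norm.
rewrite /= mul1r rmorphXn/= -cplx_normE mulrCA ler_piMr ?exprn_ge0//.
have [Wt0 _] := row_stochastic_exp n W_stoch.
rewrite -rmorphM -(rmorph1 (@to_cplx R)) to_cplx_le mulr_ile1//.
  by rewrite ger0_norm ?subr_ge0// gerBl sumr_ge0.
by rewrite ger0_norm//; exact/row_stochastic_le1/row_stochastic_exp.
Qed.

(** As [Relc] is idempotent, [1%:M + (z / (1 - z)) *: Relc] is a left inverse of [1%:M - z *: Relc];
    it recovers [PG] from [PG - z *: (Relc *m PG)]. *)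
Lemma propagator_gfE : propagator_gf P u =
  (1%:M + (psi_gf psi u / (1 - psi_gf psi u)) *: Relc)
    *m (1%:M - psi_gf_mx psi (u *: Wc)) *m invmx (1%:M - u *: Wc).
Proof.
set z := psi_gf psi u; set PG := propagator_gf P u.
have z1 : 1 - z != 0 := psi_gf_neq1.
have Relc_idem : Relc *m Relc = Relc by rewrite /Relc /to_cplx_mx -map_mxM Rel_idem.
(* Both sides are limits of [G_ n *m (1%:M - u *: Wc)]. *)
have GE : (PG - z *: (Relc *m PG)) *m (1%:M - u *: Wc) =
          1%:M - psi_gf_mx psi (u *: Wc).
  by rewrite -(limn_mx cvg_G_mul) (limn_mx (cvgn_mulmxr cvg_G)).
rewrite -mulmxA -GE mulmxK ?unitmx_1_sub_walk//.
rewrite mulmxDl mul1mx -scalemxAl mulmxBr -scalemxAr mulmxA Relc_idem.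
set RP := Relc *m PG.
by rewrite -[in X in _ *: (X - _)](scale1r RP) -scalerBl scalerA divfK// subrK.
Qed.

End GeneratingFunction.

(** * Real-valued probabilities and finite partitions of events *)

Section ProbabilityPreliminaries.
Context d (T : measurableType d) (R : realType) (Pr : probability T R).
Implicit Types (A B E : set T).

Lemma prob_ge0 E : 0 <= prob Pr E.
Proof. by rewrite /prob fine_ge0. Qed.

Lemma probE E : measurable E -> (prob Pr E)%:E = Pr E.
Proof. by move=> mE; rewrite fineK// fin_num_measure. Qed.

Lemma prob0 : prob Pr set0 = 0.
Proof. by rewrite /prob measure0. Qed.

Lemma probT : prob Pr setT = 1.
Proof. by rewrite /prob probability_setT. Qed.

Lemma prob_le A B : measurable A -> measurable B -> A `<=` B ->
  prob Pr A <= prob Pr B.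
Proof.
by move=> mA mB AB; rewrite -lee_fin !probE// le_measure// inE.
Qed.

Lemma probU A B : measurable A -> measurable B -> A `&` B = set0 ->
  prob Pr (A `|` B) = prob Pr A + prob Pr B.
Proof.
move=> mA mB AB; apply: EFin_inj.
by rewrite EFinD !probE ?measureU//; exact: measurableU.
Qed.

(** Only the slices are assumed measurable, so that [X] can be [reset_count], defined by a choice;
    measurability of the union is then part of the conclusion. *)
Lemma prob_split E (X : T -> nat) m :
  (forall k, (k < m)%N -> measurable (E `&` [set w | X w = k])) ->
  measurable (E `&` [set w | (X w < m)%N]) /\
  prob Pr (E `&` [set w | (X w < m)%N]) =
  \sum_(0 <= k < m) prob Pr (E `&` [set w | X w = k]).
Proof.
elim: m => [|m IH] mE.
  have -> : E `&` [set w | (X w < 0)%N] = set0 by apply/seteqP; split=> w [].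
  by rewrite prob0 big_geq.
have [k km|mI pI] := IH; first by apply: mE; rewrite ltnS ltnW.
have EU : E `&` [set w | (X w < m.+1)%N] =
    (E `&` [set w | (X w < m)%N]) `|` (E `&` [set w | X w = m]).
  apply/seteqP; split=> w /=.
    by move=> [Ew]; rewrite ltnS leq_eqVlt => /orP[/eqP|]; [right|left].
  by move=> [[Ew /ltnW]|[Ew ->]].
have mm : measurable (E `&` [set w | X w = m]) by exact: mE.
rewrite EU; split; first exact: measurableU.
rewrite probU ?pI ?big_nat_recr//.
by apply/seteqP; split=> w //= -[[_ +] [_ Xm]]; rewrite Xm ltnn.
Qed.

Lemma expectation_lin_indic m (c : nat -> R) (A : nat -> set T) :
  (forall b, measurable (A b)) ->
  fine ('E_Pr[fun w => (\sum_(0 <= b < m) c b * \1_(A b) w)%R])%E =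
  \sum_(0 <= b < m) c b * prob Pr (A b).
Proof.
move=> mA.
(* Integrability is carried through the induction, because additivity of the expectation requires
   it. *)
suff [_ ->] : (fun w => (\sum_(0 <= b < m) c b * \1_(A b) w)%R) \in Lfun Pr 1 /\
  ('E_Pr[fun w => (\sum_(0 <= b < m) c b * \1_(A b) w)%R] =
   (\sum_(0 <= b < m) c b * prob Pr (A b))%:E)%E by [].
have LA b : (\1_(A b) : T -> R) \in Lfun Pr 1.
  by apply/Lfun1_integrable; exact: integrable_indic.
elim: m => [|m [IL IE]].
  have -> : (fun w => (\sum_(0 <= b < 0) c b * \1_(A b) w)%R) = cst 0.
    by apply/funext => w; rewrite big_geq.
  by rewrite expectation_cst big_geq//; split => //; rewrite Lfun_cst.
have -> : (fun w => (\sum_(0 <= b < m.+1) c b * \1_(A b) w)%R) =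
    (fun w => (\sum_(0 <= b < m) c b * \1_(A b) w)%R) \+ (c m \o* \1_(A m)).
  by apply/funext => w; rewrite big_nat_recr//= [c m * _]mulrC.
have LZ : (c m \o* \1_(A m)) \in Lfun Pr 1.
  rewrite (_ : _ \o* _ = c m *: (\1_(A m) : T -> R)) ?rpredZ//.
  by apply/funext => w; exact: mulrC.
split; first exact: rpredD.
rewrite expectationD// IE expectationZl// expectation_indic// -probE//.
by rewrite -EFinM -EFinD big_nat_recr.
Qed.

End ProbabilityPreliminaries.

(** Both double sums range over the pairs with [b + k <= t]. *)
Lemma sum_nat_triangle (V : nmodType) (F : nat -> nat -> V) t :
  \sum_(0 <= k < t.+1) \sum_(0 <= b < (t - k).+1) F k b =
  \sum_(0 <= b < t.+1) \sum_(0 <= k < (t - b).+1) F k b.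
Proof.
have widen (G : nat -> V) k : (k < t.+1)%N ->
    \sum_(0 <= b < (t - k).+1) G b = \sum_(0 <= b < t.+1 | (b + k <= t)%N) G b.
  rewrite ltnS => kt; rewrite (big_nat_widen _ _ t.+1) ?ltnS ?leq_subr//.
  by apply: eq_bigl => b; rewrite ltnS leq_subRL// addnC.
transitivity (\sum_(0 <= k < t.+1) \sum_(0 <= b < t.+1 | (b + k <= t)%N) F k b).
  by apply: eq_big_nat => k /andP[_ kt]; rewrite widen.
rewrite (exchange_big_dep_nat predT)//=; apply: eq_big_nat => b /andP[_ bt].
by rewrite widen//; apply: eq_bigl => k; rewrite addnC.
Qed.

(** * The reset times as a discrete renewal process *)

Section Renewal.
Context (R : realType) d (T : measurableType d) (Pr : probability T R).
Variable dt : nat -> {RV Pr >-> nat}.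
Hypotheses (dt_indep : mutually_independent dt)
  (dt_id : identically_distributed dt) (dt_gt0 : forall n w, (0 < dt n w)%N).
Let J := reset_time dt.
Let psi := waiting_law dt.

Lemma measurable_dt n (B : set nat) : measurable (dt n @^-1` B).
Proof. exact: (measurable_funPTI (dt n)). Qed.

Lemma reset_time0 w : J 0%N w = 0%N.
Proof. by rewrite /J /reset_time big_ord0. Qed.

Lemma reset_timeS n w : J n.+1 w = (J n w + dt n w)%N.
Proof. by rewrite /J /reset_time big_ord_recr. Qed.

Lemma measurable_reset_time n (B : set nat) : measurable (J n @^-1` B).
Proof.
have mJ : measurable_fun setT (J n).
  elim: n => [|n IH].
    by rewrite (_ : J 0 = cst 0%N)//; apply/funext => w; exact: reset_time0.
  rewrite (_ : J n.+1 = (fun w => (J n w + dt n w)%N)).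
    by apply: measurable_realfun.measurable_fun_addn.
  by apply/funext => w; exact: reset_timeS.
by rewrite -[_ @^-1` _]setTI; exact: mJ.
Qed.

(** This bound makes every series over the number of resets a finite sum. *)
Lemma reset_time_ge n w : (n <= J n w)%N.
Proof.
elim: n => // n IH; rewrite reset_timeS -addn1.
exact: leq_add.
Qed.

Lemma reset_time_mono m n w : (m <= n)%N -> (J m w <= J n w)%N.
Proof.
move=> /subnKC <-; elim: (n - m)%N => [|k IH]; first by rewrite addn0.
by rewrite addnS reset_timeS (leq_trans IH)// leq_addr.
Qed.

(** Cylinder events of the waiting times, the events whose probability [mutually_independent]
    factorizes. *)
Let cyl (s : {fset nat}) (B : nat -> set nat) : set T :=
  \bigcap_(i in [set` s]) (dt i @^-1` B i).

Let measurable_cyl s B : measurable (cyl s B).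
Proof. by apply: fin_bigcap_measurable => // i _; exact: measurable_dt. Qed.

Let prob_cyl s B : prob Pr (cyl s B) = \prod_(i <- s) prob Pr (dt i @^-1` B i).
Proof.
apply: EFin_inj; rewrite probE// /cyl dt_indep//.
rewrite -prodEFin; apply: eq_bigr => i _.
by rewrite probE//; exact: measurable_dt.
Qed.

Let cylU1 n (s : {fset nat}) B C : n \notin s ->
  cyl (n |` s)%fset (fun i => if i == n then C else B i) =
  (dt n @^-1` C) `&` cyl s B.
Proof.
move=> ns; apply/seteqP; split=> w /=.
  move=> h; split.
    by have := h n; rewrite /= eqxx; apply; exact: fset1U1.
  move=> i /= si; have := h i; rewrite /= ifF.
    by apply; rewrite /= in_fset1U si orbT.
  by apply/eqP => iE; rewrite iE in si; rewrite si in ns.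
move=> [Cn h] i /=; rewrite in_fset1U => /orP[/eqP->|si]; first by rewrite eqxx.
case: eqP => [->//|_]; exact: h.
Qed.

(** [J n] depends only on the waiting times of index below [n]. In the induction, [J n.+1 = a] is
    split by the value [k] of [dt n], and the condition [dt n = k] joins the cylinder, whose indices
    are still at least [n]; hence the statement for arbitrary cylinders. *)
Let prob_reset_time_cyl n a (s : {fset nat}) B : (forall i, i \in s -> (n <= i)%N) ->
  prob Pr ([set w | J n w = a] `&` cyl s B) =
  prob Pr [set w | J n w = a] * prob Pr (cyl s B).
Proof.
elim: n a s B => [|n IH] a s B sn.
  have [->|a0] := eqVneq a 0%N.
    rewrite (_ : [set w | J 0 w = 0%N] = setT) ?probT ?mul1r ?setTI//.
    by apply/seteqP; split=> // w _; exact: reset_time0.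
  rewrite (_ : [set w | J 0 w = a] = set0) ?set0I ?prob0 ?mul0r//.
  apply/seteqP; split=> // w /=; rewrite reset_time0 => aE.
  by rewrite -aE in a0.
have nns : n \notin s by apply/negP => /sn; rewrite ltnn.
(* The case [s = fset0] computes the law of [J n.+1]. *)
have step (s' : {fset nat}) B' : n \notin s' -> (forall i, i \in s' -> (n <= i)%N) ->
    prob Pr ([set w | J n.+1 w = a] `&` cyl s' B') =
    (\sum_(0 <= k < a.+1) prob Pr [set w | J n w = (a - k)%N] *
        prob Pr (dt n @^-1` [set k])) * prob Pr (cyl s' B').
  move=> ns' sn'.
  have EE k : (k < a.+1)%N ->
      ([set w | J n.+1 w = a] `&` cyl s' B') `&` [set w | dt n w = k] =
      [set w | J n w = (a - k)%N] `&`
        cyl (n |` s')%fset (fun i => if i == n then [set k] else B' i).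
    move=> ka; rewrite cylU1//; apply/seteqP; split=> w /=.
      by move=> [[+ cw] kE]; rewrite reset_timeS kE => <-; rewrite addnK.
    move=> [JE [kE cw]]; split; last by [].
    split; last by [].
    by rewrite reset_timeS JE kE subnK.
  have [k ka|_] := @prob_split _ _ _ Pr
      ([set w | J n.+1 w = a] `&` cyl s' B') (dt n) a.+1.
    rewrite EE//; apply: measurableI => //.
    exact: (measurable_reset_time n [set (a - k)%N]).
  rewrite (_ : _ `&` [set w | (dt n w < a.+1)%N] =
    [set w | J n.+1 w = a] `&` cyl s' B').
    move=> ->; rewrite mulr_suml; apply: eq_big_nat => k /andP[_ ka].
    rewrite EE// IH; last by move=> i; rewrite in_fset1U => /orP[/eqP->|/sn'].
    rewrite -mulrA; congr (_ * _).
    rewrite !prob_cyl big_fsetU1//= eqxx; congr (_ * _).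
    rewrite big_seq [RHS]big_seq; apply: eq_bigr => i is'.
    by case: eqP => // iE; rewrite iE (negPf ns') in is'.
  apply/seteqP; split=> w /=; first by case.
  move=> [Ja cw]; split; first by [].
  by rewrite ltnS -Ja reset_timeS leq_addl.
rewrite step//; last by move=> i /sn /ltnW.
have := step fset0 B; rewrite (_ : cyl fset0 B = setT) ?probT ?setIT ?mulr1.
  by move=> ->.
by apply/seteqP; split=> // w _ i.
Qed.

Lemma prob_dt_id n (B : set nat) :
  prob Pr (dt n @^-1` B) = prob Pr (dt 0%N @^-1` B).
Proof. by rewrite /prob; congr fine; exact: dt_id. Qed.

Let p n s := prob Pr [set w | J n w = s].

Lemma prob_reset_time_dt n a (B : set nat) :
  prob Pr [set w | J n w = a /\ B (dt n w)] = p n a * prob Pr (dt 0%N @^-1` B).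
Proof.
have cE : cyl [fset n]%fset (fun=> B) = dt n @^-1` B.
  apply/seteqP; split=> w /=; first by apply; rewrite /= inE.
  by move=> Bw i /=; rewrite inE => /eqP->.
rewrite -(prob_dt_id n) -cE -prob_reset_time_cyl ?cE// => i.
by rewrite inE => /eqP->.
Qed.

Lemma prob_reset_timeS n s :
  p n.+1 s = \sum_(0 <= k < s.+1) psi k * p n (s - k)%N.
Proof.
have EE k : (k < s.+1)%N -> [set w | J n.+1 w = s] `&` [set w | dt n w = k] =
    [set w | J n w = (s - k)%N /\ [set k] (dt n w)].
  move=> ka; apply/seteqP; split=> w /=; rewrite reset_timeS.
    by move=> [<- ->]; rewrite addnK.
  by move=> [-> ->]; rewrite subnK.
have [k ks|_] := @prob_split _ _ _ Pr [set w | J n.+1 w = s] (dt n) s.+1.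
  apply: measurableI; first exact: (measurable_reset_time n.+1 [set s]).
  exact: (measurable_dt n [set k]).
rewrite (_ : _ `&` [set w | (dt n w < s.+1)%N] = [set w | J n.+1 w = s]).
  rewrite /p => ->; apply: eq_big_nat => k /andP[_ ka].
  by rewrite EE// prob_reset_time_dt mulrC.
apply/seteqP; split=> w /=; first by case.
by move=> <-; split => //; rewrite ltnS reset_timeS leq_addl.
Qed.

Lemma waiting_law0 : psi 0%N = 0.
Proof.
rewrite /psi /waiting_law (_ : [set w | _] = set0) ?prob0//.
by apply/seteqP; split=> // w /= dt0; have := dt_gt0 0 w; rewrite dt0.
Qed.

Lemma waiting_law_ge0 r : 0 <= psi r.
Proof. exact: prob_ge0. Qed.

Lemma sum_waiting_law n :
  \sum_(0 <= r < n) psi r = prob Pr [set w | (dt 0%N w < n)%N].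
Proof.
have [k kn|_] := @prob_split _ _ _ Pr setT (dt 0%N) n.
  by rewrite setTI; exact: (measurable_dt 0 [set k]).
by rewrite setTI => ->; apply: eq_bigr => k _; rewrite setTI.
Qed.

Lemma sum_waiting_law_le1 n : \sum_(0 <= r < n) psi r <= 1.
Proof.
rewrite sum_waiting_law -(probT Pr); apply: prob_le => //.
exact: (measurable_dt 0 [set k | (k < n)%N]).
Qed.

(** The waiting time is finite everywhere, so the increasing events [dt 0 < n] exhaust the space;
    continuity from below gives total mass 1. *)
Lemma cvg_sum_waiting_law :
  (fun n => \sum_(0 <= r < n) psi r) @ \oo --> (1 : R).
Proof.
under eq_fun do rewrite sum_waiting_law.
pose F n := [set w | (dt 0%N w < n)%N].
have FT : \bigcup_n F n = setT.
  by apply/seteqP; split=> // w _; exists (dt 0%N w).+1 => //=; exact: ltnSn.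
have mF n : measurable (F n) by exact: (measurable_dt 0 [set k | (k < n)%N]).
have := @nondecreasing_cvg_mu _ _ _ Pr F mF.
rewrite FT => /(_ measurableT) cF.
apply: fine_cvg; rewrite -[X in _ --> X](probability_setT Pr).
apply: cF => m n mn; apply/subsetPset => w /= h; exact: leq_trans h mn.
Qed.

Lemma Phi0_1_sub t : Phi0 psi t = 1 - \sum_(0 <= r < t.+1) psi r.
Proof.
apply/cvg_lim => //.
apply: cvg_trans (cvgB cvg_sum_waiting_law (cvg_cst _)).
apply: near_eq_cvg; near=> n.
rewrite -[LHS]/(\sum_(0 <= r < n) psi r - \sum_(0 <= r < t.+1) psi r).
rewrite [in LHS](big_cat_nat (n := t.+1))//=.
  by rewrite [X in X - _]addrC addrK.
by near: n; exact: nbhs_infty_ge.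
Unshelve. all: by end_near. Qed.

Lemma Phi0_prob t : Phi0 psi t = prob Pr [set w | (t < dt 0%N w)%N].
Proof.
rewrite Phi0_1_sub sum_waiting_law.
set A := [set w | (dt 0%N w < t.+1)%N]; set B := [set w | (t < dt 0%N w)%N].
have mA : measurable A by exact: (measurable_dt 0 [set k | (k < t.+1)%N]).
have mB : measurable B by exact: (measurable_dt 0 [set k | (t < k)%N]).
have AB0 : A `&` B = set0.
  by apply/seteqP; split=> w //= -[]; rewrite /A /B/= ltnS leqNgt => /negP.
have ABT : A `|` B = setT.
  apply/seteqP; split=> // w _; rewrite /A /B/= ltnS.
  by apply/orP; rewrite leqNgt orNb.
by apply/eqP; rewrite subr_eq addrC -probU// ABT probT.
Qed.

Lemma prob_reset_time0 s : p 0%N s = (s == 0%N)%:R.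
Proof.
rewrite /p; have [->|s0] := eqVneq s 0%N.
  rewrite (_ : [set w | _] = setT) ?probT//.
  by apply/seteqP; split=> // w _; exact: reset_time0.
rewrite (_ : [set w | _] = set0) ?prob0//.
apply/seteqP; split=> // w /=; rewrite reset_time0 => sE.
by rewrite -sE in s0.
Qed.

Lemma prob_reset_time_lt n s : (s < n)%N -> p n s = 0.
Proof.
move=> sn; rewrite /p (_ : [set w | _] = set0) ?prob0//.
apply/seteqP; split=> // w /= Js.
by have := reset_time_ge n w; rewrite Js leqNgt sn.
Qed.

(* The reset rate at [s]: [J n >= n], so that no [n > s] contributes. *)
Let g s := \sum_(1 <= n < s.+1) p n s.

Lemma sum_prob_reset_time s m : (s < m)%N -> \sum_(1 <= n < m) p n s = g s.
Proof.
move=> sm; rewrite (big_cat_nat (n := s.+1))//= [X in _ + X]big_nat_cond.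
rewrite [X in _ + X]big1 ?addr0//.
by move=> n /andP[/andP[sn _] _]; exact: prob_reset_time_lt.
Qed.

(** The partial sums are constant once [m > s]. At [s = 0] the convention of a zero rate agrees with
    the empty sum [g 0]. *)
Lemma reset_rateE (s : nat) : reset_rate dt s%:Z = g s.
Proof.
rewrite /reset_rate; case: ltrP => [s0|]; last first.
  by rewrite lez_nat leqn0 => /eqP ->; rewrite /g big_geq.
apply/norm_lim_near_cst; near=> m.
rewrite -(@sum_prob_reset_time s m); last by near: m; exact: nbhs_infty_gt.
apply: eq_bigr => n _; congr (prob Pr _).
by apply/seteqP; split=> w /= => [[]|<-].
Unshelve. all: by end_near. Qed.

(** Summing [prob_reset_timeS] over [n] shifts the index down by one, so the sum now includes [J 0],
    which contributes the Kronecker delta. *)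
Lemma renewal_rate s :
  g s = \sum_(0 <= k < s.+1) psi k * (((s - k)%N == 0%N)%:R + g (s - k)%N).
Proof.
rewrite [LHS]/g big_add1/=.
under eq_bigr do rewrite prob_reset_timeS.
rewrite exchange_big/=; apply: eq_big_nat => -[|k] /andP[_ ks].
  (* For [k = 0] the range [n < s] is too short to yield [g s], but [psi 0 = 0]; for [k >= 1] it
     contains every [n <= s - k]. *)
  by rewrite waiting_law0 mul0r big1// => n _; rewrite mul0r.
rewrite -mulr_sumr; congr (_ * _); rewrite -prob_reset_time0.
have s0 : (0 < s)%N by exact: leq_ltn_trans (leq0n k) (ks : (k < s)%N).
by rewrite [LHS]big_ltn// sum_prob_reset_time// ltn_subrL.
Qed.

(** For [b <= t], this is the event that exactly [n] resets occur up to time [t] and that the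
    backward recurrence time is [b]. *)
Let age n t b := [set w | J n w = (t - b)%N /\ (b < dt n w)%N].

Let measurable_age n t b : measurable (age n t b).
Proof.
rewrite (_ : age n t b =
  J n @^-1` [set (t - b)%N] `&` dt n @^-1` [set k | (b < k)%N])//.
by apply: measurableI; [exact: measurable_reset_time|exact: measurable_dt].
Qed.

Let prob_age n t b : prob Pr (age n t b) = p n (t - b)%N * Phi0 psi b.
Proof.
by rewrite Phi0_prob (prob_reset_time_dt n (t - b)%N [set k | (b < k)%N]).
Qed.

(** The set under [get] has at most one element, so the choice is determined. It is nonempty since
    [J 0 = 0] and [n <= J n] bounds the candidates by [t]. *)
Lemma reset_countP t w n :
  reset_count dt t w = n <-> (J n w <= t < J n.+1 w)%N.
Proof.
pose S := [set n | (J n w <= t)%N /\ forall m, (J m w <= t)%N -> (m <= n)%N].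
have maxS k : (J k w <= t < J k.+1 w)%N -> S k.
  move=> /andP[Jt tJ]; split=> // m Jm; rewrite leqNgt; apply/negP => km.
  by have := leq_trans tJ (leq_trans (reset_time_mono w km) Jm); rewrite ltnn.
have get_eq k : (J k w <= t < J k.+1 w)%N -> reset_count dt t w = k.
  move=> /maxS Sk; have [h1 h2] : S (reset_count dt t w).
    exact: (getPex (ex_intro S k Sk)).
  by apply/eqP; rewrite eqn_leq (Sk.2 _ h1) (h2 _ Sk.1).
split=> [<-|]; last exact: get_eq.
have exJ : exists n, (J n w <= t)%N by exists 0%N; rewrite reset_time0.
have ubJ n' : (J n' w <= t)%N -> (n' <= t)%N by exact: leq_trans (reset_time_ge _ _).
have [k Jk kmax] := ex_maxnP exJ ubJ.
have kP : (J k w <= t < J k.+1 w)%N.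
  by rewrite Jk ltnNge; apply/negP => /kmax; rewrite ltnn.
by rewrite (get_eq k kP).
Qed.

Let backward_age t b n : (b <= t)%N ->
  [set w | backward_time dt t w = b] `&` [set w | reset_count dt t w = n] =
  age n t b.
Proof.
move=> bt; apply/seteqP; split=> w /=; rewrite /backward_time.
  move=> [bE nE]; have /andP[Jt] := (reset_countP t w n).1 nE.
  rewrite reset_timeS => tJ; rewrite -bE nE -/J.
  by split; [rewrite subKn|rewrite ltn_subLR].
move=> [JE bdt]; have nE : reset_count dt t w = n.
  apply/reset_countP; rewrite reset_timeS JE leq_subr/=.
  by rewrite -{1}(subnK bt) ltn_add2l.
by split=> //; rewrite nE -/J JE subKn.
Qed.

(** The event is partitioned by the number of resets, which is at most [t]. The term without reset
    gives the Kronecker delta, the others add up to [g]. *)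
Lemma backward_lawE t b : (b <= t)%N -> backward_law dt t b =
  Phi0 psi b * (((t - b)%N == 0%N)%:R + g (t - b)%N).
Proof.
move=> bt.
have [n nt|_] := @prob_split _ _ _ Pr [set w | backward_time dt t w = b]
    (reset_count dt t) t.+1.
  by rewrite backward_age.
rewrite (_ : _ `&` [set w | (reset_count dt t w < t.+1)%N] =
  [set w | backward_time dt t w = b]).
  rewrite /backward_law => ->.
  under eq_bigr do rewrite backward_age// prob_age.
  rewrite -mulr_suml mulrC big_ltn// prob_reset_time0 sum_prob_reset_time//.
  by rewrite ltnS leq_subr.
apply/seteqP; split=> w /=; first by case.
move=> bE; split=> //; rewrite ltnS.
have /andP[Jt _] := (reset_countP t w _).1 erefl.
exact: leq_trans (reset_time_ge _ _) Jt.
Qed.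

Lemma backward_law_reset_rate t b : backward_law dt t b =
  Phi0 psi b * ((t == b)%:R + reset_rate dt (t%:Z - b%:Z)).
Proof.
have [bt|tb] := leqP b t.
  rewrite backward_lawE// subzn// reset_rateE subn_eq0.
  by rewrite [t == b]eqn_leq bt andbT.
(* For [b > t] both sides vanish: the rate has a negative argument, and the backward time never
   exceeds [t]. *)
rewrite /reset_rate ltNge subr_le0 lez_nat (ltnW tb)/= (ltn_eqF tb) addr0 mulr0.
rewrite /backward_law (_ : [set w | _] = set0) ?prob0//.
apply/seteqP; split=> // w /= bE.
have := leq_subr (J (reset_count dt t w) w) t.
by rewrite [X in (X <= _)%N]bE leqNgt tb.
Qed.

(** * The propagator: backward recurrence formula and renewal equation *)

Section Propagator.
Variables (N : nat) (W Rel : 'M[R]_N).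

(** Where [Theta] is 1, exactly one [age n t b] occurs, with [b = t - J n]; elsewhere none does. The
    integrand is thus a finite combination of indicators with coefficients [W ^+ b]. *)
Let expectation_age t n : mx_expectation Pr
    (fun w => Theta R (J n w) t (J n.+1 w) *: W ^+ (t - J n w)) =
  \sum_(0 <= b < t.+1) (Phi0 psi b * p n (t - b)%N) *: W ^+ b.
Proof.
apply/matrixP => i j; rewrite mxE summxE.
rewrite (_ : (fun w => _) = (fun w => \sum_(0 <= b < t.+1)
    (W ^+ b) i j * \1_(age n t b) w)).
  rewrite expectation_lin_indic//; apply: eq_bigr => b _.
  by rewrite prob_age mxE mulrC [_ * p _ _]mulrC.
apply/funext => w; rewrite mxE /Theta.
(* The subtraction is truncated; positivity of [J n.+1] excludes the bad case. *)
have tE : (t <= J n.+1 w - 1)%N = (t < J n.+1 w)%N.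
  by rewrite subn1 -ltnS prednK// reset_timeS (leq_trans (dt_gt0 n w))// leq_addl.
rewrite tE; have [/andP[Jt tJ]|JtJ] := boolP (J n w <= t < J n.+1 w)%N.
  rewrite mul1r big_mkord (bigD1 (inord (t - J n w)))//=.
  rewrite inordK ?ltnS ?leq_subr// indicE mem_set; last first.
    by rewrite /age/= subKn//; split=> //; rewrite ltn_subLR// -reset_timeS.
  rewrite mulr1 big1 ?addr0// => k /eqP kJ; rewrite indicE memNset ?mulr0//.
  move=> [JE _]; apply: kJ; apply/val_inj => /=.
  by rewrite inordK ?ltnS ?leq_subr// JE subKn// -ltnS.
rewrite mul0r big_nat_cond big1// => b /andP[/andP[_ bt] _].
rewrite indicE memNset ?mulr0// => -[JE bdt]; move/negP: JtJ; apply.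
by rewrite reset_timeS JE leq_subr/= -{1}(subnK (bt : (b <= t)%N)) ltn_add2l.
Qed.

(** The sums under the limit are constant once [m > t], since [J n] cannot equal [t - b] for
    [n > t]. *)
Lemma propagatorE t : propagator dt W Rel t = Phi0 psi t *: W ^+ t +
  Rel *m \sum_(0 <= b < t.+1) (Phi0 psi b * g (t - b)%N) *: W ^+ b.
Proof.
rewrite /propagator -/J; congr (_ *: _ + Rel *m _).
  rewrite (_ : (fun w => _) = \1_[set w | (t < dt 0%N w)%N]).
    rewrite expectation_indic ?Phi0_prob//.
    exact: (measurable_dt 0 [set k | (t < k)%N]).
  apply/funext => w; rewrite /Theta indicE reset_timeS reset_time0 add0n/=.
  by rewrite mem_setE subn1 -ltnS prednK.
apply: limn_mx; apply: cvg_near_cst; near=> m.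
under eq_bigr do rewrite expectation_age.
rewrite exchange_big/=; apply: eq_big_nat => b /andP[_ bt].
rewrite -scaler_suml -mulr_sumr; congr ((_ * _) *: _).
apply: sum_prob_reset_time; apply: leq_ltn_trans (leq_subr _ _) _.
by near: m; exact: nbhs_infty_gt.
Unshelve. all: by end_near. Qed.

(** The coefficients [backward_law dt t b] agree with those of [propagatorE] except at [b = t],
    where the delta adds [Phi0 psi t]. The factor [1%:M - Rel] compensates for this term. *)
Lemma propagator_backward t : propagator dt W Rel t =
  Phi0 psi t *: ((1%:M - Rel) *m W ^+ t) +
  Rel *m \sum_(0 <= b < t.+1) backward_law dt t b *: W ^+ b.
Proof.
rewrite propagatorE mulmxBl mul1mx scalerBr -addrA; congr (_ + _).
rewrite scalemxAr addrC -mulmxBr; congr (_ *m _).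
rewrite big_nat_recr//= [in RHS]big_nat_recr//= -addrA; congr (_ + _).
  apply: eq_big_nat => b /andP[_ bt].
  by rewrite (backward_lawE (ltnW bt)) subn_eq0 leqNgt bt add0r.
have g0 : g 0 = 0 by rewrite /g big_geq.
rewrite (backward_lawE (leqnn t)) subnn g0.
by rewrite mulr0 scale0r addr0 mulr1 subrr.
Qed.

Hypothesis Rel_idem : Rel *m Rel = Rel.

(** Idempotence gives [Rel *m (1%:M - Rel) = 0], which removes the no-reset term. *)
Let mul_propagator t : Rel *m propagator dt W Rel t =
  Rel *m \sum_(0 <= b < t.+1) backward_law dt t b *: W ^+ b.
Proof.
rewrite propagator_backward mulmxDr -scalemxAr !mulmxA mulmxBr mulmx1 Rel_idem.
by rewrite subrr mul0mx scaler0 add0r.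
Qed.

(** By [mul_propagator] the right-hand sum is a convolution of [psi] with [backward_law]. After
    exchanging sums, the coefficient of [W ^+ b] is [Phi0 psi b] times the right-hand side of
    [renewal_rate] at [t - b]. *)
Lemma propagator_renewal t : propagator dt W Rel t = Phi0 psi t *: W ^+ t +
  Rel *m \sum_(1 <= k < t.+1) psi k *: propagator dt W Rel (t - k)%N.
Proof.
rewrite {1}propagatorE; congr (_ + _).
transitivity (Rel *m \sum_(0 <= k < t.+1) \sum_(0 <= b < (t - k).+1)
    (psi k * backward_law dt (t - k) b) *: W ^+ b); last first.
  rewrite big_ltn// [X in X + _]big1 ?add0r => [|b _].
    rewrite !mulmx_sumr; apply: eq_bigr => k _.
    rewrite -scalemxAr mul_propagator scalemxAr scaler_sumr; congr (_ *m _).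
    by apply: eq_bigr => b _; rewrite scalerA.
  by rewrite waiting_law0 mul0r scale0r.
congr (_ *m _); rewrite sum_nat_triangle; apply: eq_big_nat => b /andP[_ bt].
rewrite -scaler_suml; congr (_ *: _); rewrite renewal_rate mulr_sumr.
apply: eq_big_nat => k /andP[_ kt].
have bkt : (b + k <= t)%N by rewrite -leq_subRL.
rewrite backward_lawE; last first.
  by rewrite leq_subRL 1?addnC// (leq_trans _ bkt)// leq_addl.
by rewrite mulrCA subnAC.
Qed.

End Propagator.

End Renewal.

(** * Walk and relocation matrices, and the final assembly *)

(* Non-bipartiteness excludes the one-node graph, whose only degree is 0. *)
Lemma walk_mx_stochastic (R : realType) (N : nat) (e : rel 'I_N) :
  irreflexive e -> (forall i j, connect e i j) -> ~ bipartite e ->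
  row_stochastic (walk_mx (adjacency_mx R e)).
Proof.
move=> e_irr e_conn e_nbip.
have neighbour i : exists j, e i j.
  apply: contrapT => /forallNP ei; apply: e_nbip; exists (fun=> true) => k l ekl.
  have iE m : m = i.
    by have /connectP[[|j s] /=] := e_conn i m => [|/andP[/ei]].
  by move: ekl; rewrite (iE k) (iE l) e_irr.
have deg_gt0 i : 0 < degree (adjacency_mx R e) i.
  have [j eij] := neighbour i; rewrite /degree (bigD1 j)//= mxE eij.
  by rewrite ltr_pwDl// sumr_ge0// => k _; rewrite mxE ler0n.
split=> [i j|i]; first by rewrite !mxE divr_ge0 ?ler0n ?ltW.
under eq_bigr do rewrite mxE.
by rewrite -mulr_suml divff ?gt_eqF// -/(degree _ i).
Qed.

Lemma relocation_mx_stochastic (R : realType) (N : nat) (rho : 'I_N -> R) :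
  (forall j, 0 <= rho j) -> \sum_j rho j = 1 ->
  row_stochastic (relocation_mx rho).
Proof.
move=> rho0 rho1; split=> [i j|i]; first by rewrite mxE.
by under eq_bigr do rewrite mxE.
Qed.

Lemma relocation_mx_idem (R : realType) (N : nat) (rho : 'I_N -> R) :
  \sum_j rho j = 1 -> relocation_mx rho *m relocation_mx rho = relocation_mx rho.
Proof.
move=> rho1; apply/matrixP => i j; rewrite !mxE.
by under eq_bigr do rewrite !mxE; rewrite -mulr_suml rho1 mul1r.
Qed.

Theorem mainTheorem1 (R : realType) (N : nat) (e : rel 'I_N)
  (e_sym : symmetric e) (e_irr : irreflexive e)
  (e_conn : forall i j, connect e i j) (e_nbip : ~ bipartite e)
  (rho : 'I_N -> R) (rho_ge0 : forall j, 0 <= rho j)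
  (rho_sum : \sum_j rho j = 1)
  (d : measure_display) (T : measurableType d) (Pr : probability T R)
  (dt : nat -> {RV Pr >-> nat})
  (dt_indep : mutually_independent dt) (dt_id : identically_distributed dt)
  (dt_gt0 : forall n w, (0 < dt n w)%N) :
  let W : 'M[R]_N := walk_mx (adjacency_mx R e) in
  let Rel : 'M[R]_N := relocation_mx rho in
  let psi : nat -> R := waiting_law dt in
  let f : nat -> nat -> R := backward_law dt in
  let P : nat -> 'M[R]_N := propagator dt W Rel in
  [/\ (forall t : nat,
         P t = Phi0 psi t *: ((1%:M - Rel) *m W ^+ t)
               + Rel *m (\sum_(0 <= b < t.+1) f t b *: W ^+ b)),
      (forall t b : nat,
         f t b = Phi0 psi b * ((t == b)%:R + reset_rate dt (t%:Z - b%:Z))),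
      (forall t : nat,
         P t = Phi0 psi t *: W ^+ t
               + Rel *m (\sum_(1 <= k < t.+1) psi k *: P (t - k)%N)) &
      (forall u : cplx R, `|u| < 1 ->
         let Wc : 'M[cplx R]_N := to_cplx_mx W in
         let Relc : 'M[cplx R]_N := to_cplx_mx Rel in
         [/\ cvgn (fun n => \sum_(1 <= r < n) to_cplx (psi r) * u ^+ r),
             cvgn (fun n => \sum_(1 <= r < n) to_cplx (psi r) *: (u *: Wc) ^+ r),
             1 - psi_gf psi u != 0 /\ 1%:M - u *: Wc \in unitmx,
             cvgn (propagator_gf_partial P u) &
             propagator_gf P u =
               (1%:M + (psi_gf psi u / (1 - psi_gf psi u)) *: Relc)
               *m (1%:M - psi_gf_mx psi (u *: Wc))
               *m invmx (1%:M - u *: Wc)])].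
Proof.
move=> W Rel psi f P.
have W_stoch : row_stochastic W by exact: walk_mx_stochastic.
have Rel_stoch : row_stochastic Rel by exact: relocation_mx_stochastic.
have Rel_idem : Rel *m Rel = Rel by exact: relocation_mx_idem.
have P_renewal := propagator_renewal dt_indep dt_id dt_gt0 W Rel_idem.
split=> //.
- exact: propagator_backward.
- exact: backward_law_reset_rate.
move=> u u1 Wc Relc.
have psi0 : psi 0%N = 0 by exact: waiting_law0.
have psi_ge0 : forall r, 0 <= psi r by exact: waiting_law_ge0.
have psi_sum := sum_waiting_law_le1 dt.
(* The generating function lemmas take the tail as 1 minus a finite sum instead of the limit
   [Phi0]. *)
have P_renewal' t : P t = (1 - \sum_(0 <= r < t.+1) psi r) *: W ^+ t +
    Rel *m \sum_(1 <= k < t.+1) psi k *: P (t - k)%N.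
  by rewrite -Phi0_1_sub// /P P_renewal.
split.
- by apply: cvgP; exact: cvg_psi_gf.
- by apply: cvgP; exact: cvg_psi_gf_mx.
- by split; [exact: psi_gf_neq1|exact: unitmx_1_sub_walk].
- by apply: cvgP; exact: (cvg_propagator_gf (W := W) (Rel := Rel) (psi := psi)).
- exact: (propagator_gfE (W := W) (Rel := Rel) (psi := psi)).
Qed.
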